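(* Let $\psi:\mathrm{Homeo}_{c}(\mathbb{R})\to\mathrm{Homeo}(\mathbb{R})$ be a continuous group morphism whose image has no (global) fixed point, i.e. there is no $x\in\mathbb{R}$ with $\psi(f)(x)=x$ for all $f\in\mathrm{Homeo}_{c}(\mathbb{R})$. Then there exists a homeomorphism $h$ of $\mathbb{R}$ such that, for every $f\in\mathrm{Homeo}_{c}(\mathbb{R})$, $$\psi(f)=h\circ f\circ h^{-1}.$$
   Context: $\mathrm{Homeo}(\mathbb{R})$ is the group of homeomorphisms of the real line and $\mathrm{Homeo}_{c}(\mathbb{R})$ is its subgroup of compactly supported homeomorphisms (those equal to the identity outside a compact set). Both groups carry the compact-open topology. *)

(* Defs.v *)
From HB Require Import structures.
From mathcomp Require Import all_boot all_order all_algebra.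
From mathcomp Require Import all_classical all_reals.
From mathcomp Require Import topology normedtype.

Set Implicit Arguments.
Unset Strict Implicit.
Unset Printing Implicit Defensive.

Local Open Scope classical_set_scope.

Record homeo (X : topologicalType) := Homeo {
  homeo_fun :> X -> X;
  homeo_inv : X -> X;
  homeo_funK : cancel homeo_fun homeo_inv;
  homeo_invK : cancel homeo_inv homeo_fun;
  homeo_fun_continuous : continuous homeo_fun;
  homeo_inv_continuous : continuous homeo_inv }.

(* The inverse is determined by the map. *)
Lemma homeo_ext (X : topologicalType) (f g : homeo X) : f =1 g -> f = g.
Proof.
case: f g => [f f' fK f'K fc f'c] [g g' gK g'K gc g'c] /= fg.
have efg : f = g by apply/funext.
have efg' : f' = g' by apply/funext => x; rewrite -{1}(g'K x) -fg fK.
case: _ / efg in gK g'K gc fg *; case: _ / efg' in gK g'K g'c *.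
by congr Homeo; exact: Prop_irrelevance.
Qed.

HB.instance Definition _ (X : topologicalType) := gen_eqMixin (homeo X).
HB.instance Definition _ (X : topologicalType) := gen_choiceMixin (homeo X).

HB.instance Definition _ (X : topologicalType) :=
  Topological.copy (homeo X)
    (@initial_topology (homeo X) {compact-open, X -> X} (@homeo_fun X)).

Section HomeoGroup.
Context (X : topologicalType).
Implicit Types f g h : homeo X.

Definition homeo_one : homeo X :=
  @Homeo X idfun idfun (fun=> erefl) (fun=> erefl)
    (fun=> cvg_id) (fun=> cvg_id).

Definition homeo_sym f : homeo X :=
  Homeo (homeo_invK f) (homeo_funK f)
    (@homeo_inv_continuous _ f) (@homeo_fun_continuous _ f).

Lemma homeo_comp_continuous f g : continuous (f \o g).
Proof.
move=> x; apply: continuous_comp; first exact: homeo_fun_continuous.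
exact: homeo_fun_continuous.
Qed.

Definition homeo_mul f g : homeo X :=
  Homeo (can_comp (homeo_funK f) (homeo_funK g))
    (can_comp (homeo_invK g) (homeo_invK f))
    (@homeo_comp_continuous f g)
    (@homeo_comp_continuous (homeo_sym g) (homeo_sym f)).

Lemma homeo_MA : associative homeo_mul.
Proof. by move=> f g h; exact: homeo_ext. Qed.
Lemma homeo_1M : left_id homeo_one homeo_mul.
Proof. by move=> f; exact: homeo_ext. Qed.
Lemma homeo_M1 : right_id homeo_one homeo_mul.
Proof. by move=> f; exact: homeo_ext. Qed.
Lemma homeo_VM : left_inverse homeo_one homeo_sym homeo_mul.
Proof. by move=> f; apply: homeo_ext => x /=; exact: homeo_funK. Qed.
Lemma homeo_MV : right_inverse homeo_one homeo_sym homeo_mul.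
Proof. by move=> f; apply: homeo_ext => x /=; exact: homeo_invK. Qed.

HB.instance Definition _ := isGroup.Build (homeo X)
  homeo_MA homeo_1M homeo_M1 homeo_VM homeo_MV.

Lemma homeoME f g : (f * g)%g = f \o g :> (X -> X). Proof. by []. Qed.
Lemma homeo1E : (1 : homeo X)%g = idfun :> (X -> X). Proof. by []. Qed.
Lemma homeoVE f : (f^-1)%g = homeo_inv f :> (X -> X). Proof. by []. Qed.

Definition compactly_supported : set (homeo X) :=
  [set f | exists2 K : set X, compact K & forall x, ~ K x -> f x = x].

(* As a [set_type], this carries the topology induced by that of [homeo X]. *)
Definition homeo_c := set_type compactly_supported.

Lemma compactly_supported_group_closed :
  group_closed (fun f => f \in compactly_supported).
Proof.
split; first by apply/mem_set; exists set0 => //; exact: compact0.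
move=> f g /set_mem[K cK Kf] /set_mem[L cL Lg]; apply/mem_set.
exists (K `|` L); first exact: compactU.
move=> x /not_orP[nK nL] /=.
have -> : homeo_inv g x = x by rewrite -{1}(Lg x nL) homeo_funK.
exact: Kf.
Qed.

HB.instance Definition _ := Topological.on homeo_c.
HB.instance Definition _ := SubChoice.on homeo_c.
HB.instance Definition _ := @SubChoice_isSubGroup.Build (homeo X)
  (fun f => f \in compactly_supported) homeo_c
  compactly_supported_group_closed.

End HomeoGroup.

(* Main.v *)
(* By continuity at the identity, a homeomorphism fixing every point of a fine
   enough finite grid moves [0] and [1] by less than [1/2], so the stabilizer of
   that grid acts by increasing maps with a bounded orbit and fixes the supremum
   of this orbit.  Among the finite sets [P] whose pointwise stabilizer fixes
   some point [z], take one of least cardinality; it is nonempty since there is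
   no global fixed point.  Moving a single point [p] of [P] inside an interval
   gives, by minimality, a continuous injective equivariant map from that
   interval to the line sending [p] to [z].  Two distinct points of [P] would
   yield two commuting such maps, which is impossible in dimension one.  Hence
   [P = {p}], and [f p |-> psi f z] is a continuous injection of the line, onto
   because an end point of its range would be a global fixed point; it is the
   conjugacy. *)

Require Import Defs.
From HB Require Import structures.
From mathcomp Require Import all_boot all_order all_algebra.
From mathcomp Require Import all_classical all_reals.
From mathcomp Require Import topology normedtype.
From mathcomp Require Import realfun ring lra.

Import numFieldNormedType.Exports.
Import Order.TTheory GRing.Theory Num.Theory.

Set Implicit Arguments.
Unset Strict Implicit.
Unset Printing Implicit Defensive.
Local Open Scope classical_set_scope.
Local Open Scope ring_scope.

(** * Monotonicity and piecewise-linear bumps on the line *)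

Section RealHomeomorphisms.
Context {R : realType}.
Implicit Types (f g : R -> R) (t u v x y : R).

Lemma continuous_injective_monotone f : continuous f -> injective f ->
  {homo f : x y / x < y} \/ {homo f : x y /~ x < y}.
Proof.
move=> cf fI.
have cT : {within [set` `]-oo, +oo[%R], continuous f}.
  by rewrite set_itvNyy; exact: continuous_subspaceT.
have [fm|fm] := itv_continuous_inj_mono cT (in2W fI); [left|right] => x y.
- by apply: fm; rewrite in_itv.
- by apply: fm; rewrite in_itv.
Qed.

(** Monotonicity identifies the preimage of []f x - e, f x + e[] with the open interval []g (f x -
    e), g (f x + e)[] around [x]. *)
Lemma increasing_surjective_continuous f g :
  {homo f : x y / x < y} -> cancel g f -> continuous f.
Proof.
move=> fI gK x; have fm := leW_mono (le_mono fI).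
apply/cvgrPdist_lt => e e0.
have xI : x \in `]g (f x - e), g (f x + e)[%R.
  by rewrite in_itv /= -[X in X && _]fm -[X in _ && X]fm !gK; lra.
near=> t; have : t \in `]g (f x - e), g (f x + e)[%R.
  by near: t; exact: near_in_itvoo.
rewrite in_itv /= -[X in X && _]fm -[X in _ && X]fm !gK.
by rewrite distrC ltr_norml; lra.
Unshelve. all: by end_near. Qed.

Lemma increasing_cancel f g : {homo f : x y / x < y} -> cancel g f ->
  {homo g : x y / x < y}.
Proof. by move=> fI gK x y xy; rewrite -(leW_mono (le_mono fI)) !gK. Qed.

Definition increasing_homeo f g (fI : {homo f : x y / x < y})
    (fK : cancel f g) (gK : cancel g f) : homeo R :=
  Homeo fK gK (increasing_surjective_continuous fI gK)
    (increasing_surjective_continuous (increasing_cancel fI gK) fK).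

(** For [x] and [y] in []u, v[], this carries [[u, x]] affinely onto [[u, y]] and [[x, v]] onto
    [[y, v]]; exchanging [x] and [y] inverts it. *)
Definition bump u v x y t : R :=
  if t <= u then t
  else if t <= x then u + (t - u) * ((y - u) / (x - u))
  else if t <= v then v - (v - t) * ((v - y) / (v - x))
  else t.

Lemma bump_at u v x y (ux : u < x) : bump u v x y x = y.
Proof.
rewrite /bump lexx leNgt ux /=; field.
by rewrite subr_eq0 gt_eqF.
Qed.

Lemma bump_out u v x y (ux : u < x) (xv : x < v) t :
  ~ (u < t < v) -> bump u v x y t = t.
Proof.
move=> utv; move/negP: utv; rewrite negb_and -!leNgt => utv.
rewrite /bump; case: leP => // ut; move: utv; rewrite leNgt ut /= => vt.
case: leP => tx; first by exfalso; lra.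
case: leP => // tv; have -> : t = v by lra.
by rewrite subrr mul0r subr0.
Qed.

(** Replaces a slope by a positive variable with a polynomial equation, so that [nra] meets no
    division. *)
Lemma slopeP (a b : R) : 0 < a -> 0 < b ->
  exists2 k, 0 < k & b / a = k /\ k * a = b.
Proof.
move=> a0 b0; exists (b / a); first exact: divr_gt0.
by split; rewrite // divfK // gt_eqF.
Qed.

Lemma bump_incr u v x y (ux : u < x) (xv : x < v)
    (uy : u < y) (yv : y < v) :
  {homo bump u v x y : s t / s < t}.
Proof.
have [||k k0 [ek hk]] := @slopeP (x - u) (y - u); [lra..|].
have [||l l0 [el hl]] := @slopeP (v - x) (v - y); [lra..|].
move=> s t st.
rewrite /bump ek el.
by case: (leP s u) => ?; case: (leP t u) => ?; case: (leP s x) => ?;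
  case: (leP t x) => ?; case: (leP s v) => ?; case: (leP t v) => ?; nra.
Qed.

(** On each affine piece the displacement is [y - x] times a ratio in [[0, 1]]. This uniform bound
    later makes the orbit maps continuous. *)
Lemma bump_close u v x y (ux : u < x) (xv : x < v) t :
  `|bump u v x y t - t| <= `|y - x|.
Proof.
rewrite /bump; case: (leP t u) => tu; first by rewrite subrr normr0.
case: (leP t x) => tx.
  have -> : u + (t - u) * ((y - u) / (x - u)) - t =
            (y - x) * ((t - u) / (x - u)) by field; rewrite subr_eq0 gt_eqF.
  rewrite normrM ler_piMr // ger0_norm ?divr_ge0 ?ler_pdivrMr ?mul1r; lra.
case: (leP t v) => tv; last by rewrite subrr normr0.
have -> : v - (v - t) * ((v - y) / (v - x)) - t =
          (y - x) * ((v - t) / (v - x)) by field; rewrite subr_eq0 gt_eqF.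
rewrite normrM ler_piMr // ger0_norm ?divr_ge0 ?ler_pdivrMr ?mul1r; lra.
Qed.

Lemma bumpK u v x y : u < x < v -> u < y < v ->
  cancel (bump u v x y) (bump u v y x).
Proof.
move=> /andP[ux xv] /andP[uy yv] t.
rewrite {2}/bump; case: leP => ut; first by rewrite /bump ut.
case: leP => tx.
  have [||k k0 [-> hk]] := @slopeP (x - u) (y - u); [lra..|].
  rewrite /bump ifF; last by apply/negbTE; rewrite -ltNge; nra.
  rewrite ifT; last by nra.
  have [||l l0 [-> hl]] := @slopeP (y - u) (x - u); [lra..|].
  have kl : k * l = 1.
    by apply: (mulIf (x := x - u)); [rewrite subr_eq0 gt_eqF|nra].
  have -> : u + (t - u) * k - u = (t - u) * k by ring.
  by rewrite -mulrA kl; ring.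
case: leP => tv; last first.
  by rewrite bump_out // => /andP[_ /lt_trans/(_ tv)]; rewrite ltxx.
have [||k k0 [-> hk]] := @slopeP (v - x) (v - y); [lra..|].
rewrite /bump ifF; last by apply/negbTE; rewrite -ltNge; nra.
rewrite ifF; last by apply/negbTE; rewrite -ltNge; nra.
rewrite ifT; last by nra.
have [||l l0 [-> hl]] := @slopeP (v - y) (v - x); [lra..|].
have kl : k * l = 1.
  by apply: (mulIf (x := v - x)); [rewrite subr_eq0 gt_eqF|nra].
have -> : v - (v - (v - t) * k) = (v - t) * k by ring.
by rewrite -mulrA kl; ring.
Qed.

Lemma homeo_c_fixes_outside (f : homeo_c R) :
  exists M : R, forall x, M < x -> val f x = x.
Proof.
case: f => f /= /set_mem [K cK Kf].
have [M [_ HM]] := compact_bounded cK.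
exists (M + 1) => x Mx; apply: Kf => Kx.
have := HM (M + 1); rewrite ltrDl ltr01 => /(_ isT x Kx) /=.
by rewrite real_ler_norml ?num_real //; lra.
Qed.

Lemma homeo_c_incr (f : homeo_c R) : {homo val f : x y / x < y}.
Proof.
have [//|fd] := continuous_injective_monotone
  (@homeo_fun_continuous _ (val f)) (can_inj (homeo_funK (val f))).
(* A decreasing map cannot be the identity beyond [M]. *)
have [M HM] := homeo_c_fixes_outside f.
have := fd (M + 2) (M + 1); rewrite !HM; lra.
Qed.

Lemma homeo_cVK (f : homeo_c R) : cancel (val f) (val f^-1%g).
Proof. exact: (homeo_funK (val f)). Qed.

Lemma homeo_cKV (f : homeo_c R) : cancel (val f^-1%g) (val f).
Proof. exact: (homeo_invK (val f)). Qed.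

Lemma ler_homeo_c (f : homeo_c R) : {mono val f : x y / x <= y}.
Proof. exact: le_mono (@homeo_c_incr f). Qed.

Lemma ltr_homeo_c (f : homeo_c R) : {mono val f : x y / x < y}.
Proof. exact: leW_mono (@ler_homeo_c f). Qed.

Lemma bump_homeo_c u v x y : u < x < v -> u < y < v ->
  exists f : homeo_c R, [/\ val f x = y,
    forall t, ~ (u < t < v) -> val f t = t &
    forall t, `|val f t - t| <= `|y - x| ].
Proof.
move=> uxv uyv; have /andP[ux xv] := uxv; have /andP[uy yv] := uyv.
pose b : homeo R :=
  increasing_homeo (bump_incr ux xv uy yv) (bumpK uxv uyv) (bumpK uyv uxv).
have bc : b \in @compactly_supported R.
  apply/mem_set; exists `[u, v]%classic; first exact: segment_compact.
  move=> t tuv; apply: bump_out => // /andP[ut tv]; apply: tuv => /=.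
  by rewrite in_itv /= !ltW.
exists (exist _ b bc); split => [|t|t] /=.
- exact: bump_at.
- exact: bump_out.
- exact: bump_close.
Qed.

End RealHomeomorphisms.

(** * Neighbourhoods of the identity in the compact-open topology *)

Section Continuity.
Context {R : realType}.

(** The sets [B] generate a filter. It converges to the identity uniformly on compact sets, as these
    are bounded, hence in the compact-open topology. *)
Lemma homeo_c_nbhs1 (W : set (homeo_c R)) : nbhs (1%g : homeo_c R) W ->
  exists M d : R, 0 < d /\ forall f : homeo_c R,
    (forall x, `|x| <= M -> `|val f x - x| < d) -> W f.
Proof.
pose B (Md : R * R) : set (R -> R) :=
  [set f | forall x, `|x| <= Md.1 -> `|f x - x| < Md.2].
pose F := filter_from [set Md : R * R | 0 < Md.2] B.
have FF : Filter F.
  apply: filter_from_filter; first by exists (0, 1) => /=.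
  move=> [M d] [N e] /= d0 e0; exists (Num.max M N, Num.min d e) => /=.
    by rewrite lt_min d0.
  move=> f Bf; split => x /= xM; have := Bf x => /=.
    by rewrite le_max xM lt_min => /(_ isT) /andP[].
  by rewrite le_max xM orbT lt_min => /(_ isT) /andP[].
have Fid : {compact-open, F --> (idfun : R -> R)}.
  apply/compact_open_fam_compactP; first by move=> x; exact: cvg_id.
  apply/fam_cvgP => A cA P /uniform_nbhs [E [entE sP]].
  move: entE; rewrite -entourage_ballE => -[e /= e0 eE].
  have [M [_ HM]] := compact_bounded cA.
  exists (M + 1, e) => //= f Bf; apply: sP => y Ay; apply: eE => /=.
  rewrite -ball_normE /= distrC; apply: Bf => /=; apply: HM => //; lra.
case=> _ [[C [D oD <-] <-] C1 CW].
have /Fid [[M d] /= d0 Bd] : nbhs (idfun : {compact-open, R -> R}) D.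
  exact: open_nbhs_nbhs.
by exists M, d; split=> // f Hf; apply: CW; apply: Bd.
Qed.

Lemma homeo_nbhs1 (y e : R) : 0 < e ->
  nbhs (1%g : homeo R) [set g : homeo R | `|g y - y| < e].
Proof.
move=> e0; apply: open_nbhs_nbhs; split; last first.
  by rewrite /= subrr normr0.
exists [set g : {compact-open, R -> R} | g @` [set y] `<=` ball y e].
  apply: compact_open_open; [exact: compact_set1|exact: ball_open].
apply/seteqP; split=> g /=.
  by move=> /(_ (g y)); rewrite -ball_normE /= distrC; apply; exists y.
by move=> gy _ [_ -> <-]; rewrite -ball_normE /= distrC.
Qed.
End Continuity.

(** * Subgroups given by a support or by fixed points *)

Section Subgroups.
Context {R : realType}.
Implicit Types (f g k : homeo_c R) (D : set R) (P : seq R).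

Lemma homeo_cM f g x : val (f * g)%g x = val f (val g x).
Proof. by []. Qed.

Definition supported_in D : set (homeo_c R) :=
  [set f : homeo_c R | forall x, ~ D x -> val f x = x].

Definition stabilizer P : set (homeo_c R) :=
  [set f : homeo_c R | {in P, forall x, val f x = x}].

Lemma homeo_cV_fix f x : val f x = x -> val f^-1%g x = x.
Proof. by move=> fx; rewrite -{1}fx homeo_cVK. Qed.

Lemma supported_inV D f : supported_in D f -> supported_in D f^-1%g.
Proof. by move=> fD x Dx; apply: homeo_cV_fix; exact: fD. Qed.

Lemma supported_inM D f g :
  supported_in D f -> supported_in D g -> supported_in D (f * g)%g.
Proof. by move=> fD gD x Dx; rewrite homeo_cM gD ?fD. Qed.

Lemma supported_in_sub D D' : D `<=` D' -> supported_in D `<=` supported_in D'.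
Proof. by move=> DD f fD x D'x; apply: fD => /DD. Qed.

Lemma stabilizerV P f : stabilizer P f -> stabilizer P f^-1%g.
Proof. by move=> fP x xP; apply: homeo_cV_fix; exact: fP. Qed.

Lemma stabilizerM P f g :
  stabilizer P f -> stabilizer P g -> stabilizer P (f * g)%g.
Proof. by move=> fP gP x xP; rewrite homeo_cM gP ?fP. Qed.

Lemma supported_in_stable D f x : supported_in D f -> D x -> D (val f x).
Proof.
move=> fD Dx; apply: contrapT => nD; have := fD _ nD.
by move=> /(can_inj (homeo_cVK f)) fx; apply: nD; rewrite fx.
Qed.

Lemma supported_in_commute D D' f g : D `&` D' = set0 ->
  supported_in D f -> supported_in D' g -> (f * g = g * f)%g.
Proof.
move=> DD' fD gD'; apply/val_inj/homeo_ext => x.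
have nDD' y : D y -> D' y -> False.
  by move=> Dy D'y; rewrite -[False]/(set0 y) -DD'.
rewrite !homeo_cM; have [Dx|Dx] := pselect (D x).
  rewrite (gD' x) ?(gD' (val f x)) //; apply: nDD' => //.
  exact: supported_in_stable Dx.
have [D'x|D'x] := pselect (D' x); last by rewrite (gD' x) // fD // gD'.
rewrite (fD x) // (fD (val g x)) // => /nDD'; apply.
exact: supported_in_stable D'x.
Qed.

Lemma bump_supported_in D x y : open D -> is_interval D -> D x -> D y ->
  exists f, [/\ supported_in D f, val f x = y &
    forall t, `|val f t - t| <= `|y - x| ].
Proof.
move=> oD iD Dx Dy.
have room t : D t -> exists2 r : R, 0 < r & D (t - r) /\ D (t + r).
  move=> Dt; have : nbhs t D by exact: open_nbhs_nbhs.
  move=> /nbhs_ballP[r /= r0 rD]; exists (r / 2); first by lra.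
  by split; apply: rD; rewrite -ball_normE /= ltr_norml; lra.
have [r r0 [ur vr]] := room x Dx; have [s s0 [us vs]] := room y Dy.
(* The bump needs end points in [D] enclosing both [x] and [y]; convexity of [D] then keeps its
   support in [D]. *)
pose u := Num.min (x - r) (y - s); pose v := Num.max (x + r) (y + s).
have Du : D u by rewrite /u; case: (leP (x - r) (y - s)).
have Dv : D v by rewrite /v; case: (leP (x + r) (y + s)).
have [||f [fxy fout fclose]] := @bump_homeo_c R u v x y.
- by rewrite /u /v gt_min lt_max; lra.
- by rewrite /u /v gt_min lt_max; lra.
exists f; split => // t Dt; apply: fout => /andP[ut tv]; apply: Dt.
by apply: (iD u v Du Dv); rewrite !ltW.
Qed.

Lemma seq_gap P p :
  exists2 r : R, 0 < r & {in P, forall q, q != p -> r <= `|q - p|}.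
Proof.
elim: P => [|q P [r r0 IH]]; first by exists 1.
exists (if q == p then r else Num.min r `|q - p|).
  by case: eqVneq => // qp; rewrite lt_min r0 normr_gt0 subr_eq0.
move=> t; rewrite inE => /orP[/eqP ->|tP] tp.
  by rewrite (negbTE tp) ge_min lexx orbT.
by case: ifP => _; [|rewrite ge_min]; rewrite IH.
Qed.

Lemma grid_stabilizer_close (M d : R) : 0 < d -> exists P, forall f,
  stabilizer P f -> forall x, `|x| <= M -> `|val f x - x| < d.
Proof.
move=> d0; pose e := d / 2; have e0 : 0 < e by rewrite /e; lra.
pose N := Num.bound (2 * M / e).
(* A grid of mesh [e] from [-M] to beyond [M]: an increasing map fixing it preserves each cell. The
   index [N] is included so that the right end of the last cell met is a grid point. *)
exists [seq e * i%:R - M | i <- iota 0 N.+1] => f fP x xM.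
have xMl : - M <= x by move: xM; rewrite ler_norml => /andP[].
have xMr : x <= M by move: xM; rewrite ler_norml => /andP[].
have t0 : 0 <= (x + M) / e by apply: divr_ge0; lra.
pose i := Num.truncn ((x + M) / e).
have /andP[iL iR] : e * i%:R - M <= x < e * i.+1%:R - M.
  have := truncn_itv t0; rewrite -/i ler_pdivlMr // ltr_pdivrMr //.
  by rewrite ![e * _]mulrC; lra.
have iN : (i < N)%N.
  rewrite -(ltr_nat R); apply: le_lt_trans (archi_boundP _); last first.
    by apply: divr_ge0; lra.
  by rewrite ler_pdivlMr // mulrC; lra.
have inP j : (j <= N)%N ->
    e * j%:R - M \in [seq e * i%:R - M | i <- iota 0 N.+1].
  by move=> jN; apply/mapP; exists j => //; rewrite mem_iota.
have fL : e * i%:R - M <= val f x.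
  by rewrite -(fP _ (inP i (ltnW iN))) ler_homeo_c.
have fR : val f x < e * i.+1%:R - M.
  by rewrite -(fP _ (inP i.+1 iN)) ltr_homeo_c.
move: iR fR; rewrite -natr1 mulrDr mulr1 => iR fR.
by rewrite ltr_norml; move: e0; rewrite /e in iL iR fL fR *; lra.
Qed.

End Subgroups.

(** * Fixed points of subgroups acting on the line through [psi] *)

Section Action.
Context {R : realType} (psi : {multiplicative homeo_c R -> homeo R}).
Implicit Types (f g k : homeo_c R) (D : set R) (P : seq R) (z : R).

Definition fixed_by (H : set (homeo_c R)) z := forall f, H f -> psi f z = z.

Lemma actM f g z : psi (f * g)%g z = psi f (psi g z).
Proof. by rewrite gmulfM. Qed.

Lemma act1 z : psi 1%g z = z.
Proof. by apply: (can_inj (homeo_funK (psi 1%g))); rewrite -actM mulg1. Qed.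

Lemma actVK f : cancel (psi f) (psi f^-1%g).
Proof. by move=> z; rewrite -actM mulVg act1. Qed.

Lemma actKV f : cancel (psi f^-1%g) (psi f).
Proof. by move=> z; rewrite -actM mulgV act1. Qed.

Lemma act_monotone f :
  {homo psi f : x y / x < y} \/ {homo psi f : x y /~ x < y}.
Proof.
apply: continuous_injective_monotone; last exact: can_inj (actVK f).
exact: homeo_fun_continuous.
Qed.

(** Invariance of [S] under inverses shows that no element of [H] lowers the supremum; applied to
    the inverse, this shows that none raises it. *)
Lemma sup_fixed (H : set (homeo_c R)) (S : set R) :
  (forall f, H f -> H f^-1%g) ->
  (forall f, H f -> {homo psi f : x y / x < y}) ->
  has_sup S -> (forall f z, H f -> S z -> S (psi f z)) -> fixed_by H (sup S).
Proof.
move=> HV Hincr [S0 Sub] HS.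
have sup_le f : H f -> sup S <= psi f (sup S).
  move=> Hf; apply: ge_sup => // z Sz; rewrite -(actKV f z).
  rewrite (le_mono (Hincr f Hf)); apply: ub_le_sup => //.
  by apply: HS => //; exact: HV.
move=> f Hf; apply/eqP; rewrite eq_le sup_le // andbT.
by rewrite -{2}(actKV f (sup S)) (le_mono (Hincr f Hf)) sup_le //; exact: HV.
Qed.

(** If [f] fixes the other points of [P], a product [g2 * g1] of elements fixing [z] imitates [f] at
    [p]: [g1] pushes [p] slightly towards [f p], and [g2] finishes the move without touching [P].
    The quotient [(g2 * g1)^-1 * f] then fixes all of [P]. *)
Lemma fixed_by_stabilizer_remove P p z (r : R) : 0 < r ->
  fixed_by (stabilizer P) z ->
  fixed_by (supported_in `]p - r, p + r[%classic) z ->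
  fixed_by (stabilizer [seq q <- P | q != p]) z.
Proof.
move=> r0 zP zr.
have inP q : q \in P -> q != p -> q \in [seq q <- P | q != p].
  by move=> qP qp; rewrite mem_filter qp.
have right f : stabilizer [seq q <- P | q != p] f -> p < val f p -> psi f z = z.
  move=> fP; set c := val f p => pc.
  have [r1 r10 gap_p] := seq_gap P p; have [r2 r20 gap_c] := seq_gap P c.
  (* A point of [P] right of [p] is fixed by [f], so it lies right of [c = f p], hence at distance
     at least [r2] from [c]. *)
  have gap q : q \in P -> ~ (p < q < c + r2).
    move=> qP /andP[pq qc].
    have fq : val f q = q by apply: fP; rewrite inP // gt_eqF.
    have cq : c < q by rewrite -fq /c ltr_homeo_c.
    have := gap_c q qP; rewrite gt_eqF // => /(_ isT).
    by rewrite ger0_norm; lra.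
  (* Radius [s] keeps the support of [g1] within distance [r] of [p] and away from the other points
     of [P]. *)
  pose s := Num.min r r1.
  have s0 : 0 < s by rewrite lt_min r0.
  have [sr sr1] : s <= r /\ s <= r1.
    by rewrite /s; split; rewrite ge_min lexx ?orbT.
  pose a := Num.min c (p + s / 2).
  have pa : p < a by rewrite lt_min pc /=; lra.
  have [ac aps] : a <= c /\ a <= p + s / 2.
    by rewrite /a; split; rewrite ge_min lexx ?orbT.
  have [||g1 [g1p g1out _]] := @bump_homeo_c R (p - s) (p + s) p a; [lra..|].
  have [||g2 [g2a g2out _]] := @bump_homeo_c R p (c + r2) a c; [lra..|].
  have g1z : psi g1 z = z.
    apply: zr => x xr; apply: g1out => xs; apply: xr.
    by rewrite /= in_itv /=; lra.
  have g2P : stabilizer P g2 by move=> q /gap; exact: g2out.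
  have kP : stabilizer P ((g2 * g1)^-1 * f)%g.
    move=> q qP; rewrite homeo_cM.
    have [->|qp] := eqVneq q p.
      by rewrite -/c (_ : c = val (g2 * g1)%g p) ?homeo_cVK // homeo_cM g1p.
    rewrite fP ?inP //; apply: homeo_cV_fix; rewrite homeo_cM g1out ?g2P //.
    have := gap_p q qP qp; move=> ? /andP[? ?].
    by have : `|q - p| < s; [rewrite ltr_norml|]; lra.
  have -> : f = (g2 * g1 * ((g2 * g1)^-1 * f))%g by rewrite mulVKg.
  by rewrite actM (zP _ kP) actM g1z zP.
move=> f fP; case: (ltgtP p (val f p)) => [|fp|fp]; first exact: right.
  have : psi f^-1%g z = z.
    apply: right; first exact: stabilizerV.
    by rewrite -(ltr_homeo_c f) homeo_cKV.
  by move=> {1}<-; rewrite actKV.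
apply: zP => q qP; have [->|qp] := eqVneq q p; first by rewrite -fp.
by apply: fP; rewrite inP.
Qed.

(** The two stabilizers generate [supported_in D]: some product of their elements agrees with [f] at
    [a], and the quotient fixes [a]. For [a < b], maps supported left of [b] fix [b], and maps
    supported right of [a] fix [a]. *)
Lemma fixed_by_supported_in D z (a b : R) :
  open D -> is_interval D -> D a -> D b ->
  a != b -> fixed_by (supported_in D `&` stabilizer [:: a]) z ->
  fixed_by (supported_in D `&` stabilizer [:: b]) z ->
  fixed_by (supported_in D) z.
Proof.
move=> oD iD; wlog ab : a b / a < b.
  move=> H Da Db; case: (ltgtP a b) => [ab|ba|//] _ za zb.
    exact: (H a b ab Da Db (negbT (lt_eqF ab))).
  exact: (H b a ba Db Da (negbT (lt_eqF ba))).
move=> Da Db _ za zb f fD.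
suff [g [gD ga gz]] : exists g,
    [/\ supported_in D g, val g a = val f a & psi g z = z].
  have kD : (supported_in D `&` stabilizer [:: a]) (g^-1 * f)%g.
    split; first by apply: supported_inM => //; exact: supported_inV.
    by move=> x; rewrite inE => /eqP ->; rewrite homeo_cM -ga homeo_cVK.
  by rewrite -[f](mulVKg g) actM (za _ kD).
have Dfa := supported_in_stable fD Da.
have move_a c : D c -> c < b -> exists g,
    [/\ supported_in D g, val g a = c & psi g z = z].
  move=> Dc cb.
  have [||||g [gD ga _]] := @bump_supported_in R (D `&` [set x | x < b]) a c.
  - by apply: openI => //; exact: open_lt.
  - move=> x y [Dx _] [Dy yb] t /andP[xt ty]; split; last exact: le_lt_trans yb.
    by apply: (iD x y) => //; rewrite xt.
  - by [].
  - by [].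
  exists g; split => //; first by apply: supported_in_sub gD => ? [].
  apply: zb; split; first by apply: supported_in_sub gD => ? [].
  by move=> x; rewrite inE => /eqP ->; apply: gD => -[_] /=; rewrite ltxx.
have [fab|baf] := ltP (val f a) b; first exact: move_a.
(* When [f a] is not left of [b], the midpoint is a relay: it is reached from [a] inside the part
   left of [b], and left for [f a] inside the part right of [a]. *)
have Dm : D ((a + b) / 2) by apply: (iD a b) => //; lra.
have [|g1 [g1D g1a g1z]] := move_a _ Dm; first lra.
have [||||g2 [g2D g2m _]] :=
    @bump_supported_in R (D `&` [set x | a < x]) ((a + b) / 2) (val f a).
- by apply: openI => //; exact: open_gt.
- move=> x y [Dx ax] [Dy _] t /andP[xt ty].
  split; last exact: lt_le_trans ax xt.
  by apply: (iD x y) => //; rewrite xt.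
- by split => //=; lra.
- by split => //=; lra.
have g2D' : supported_in D g2 by apply: supported_in_sub g2D => ? [].
exists (g2 * g1)%g; split; first exact: supported_inM.
  by rewrite homeo_cM g1a.
rewrite actM g1z; apply: za; split => //.
by move=> x; rewrite inE => /eqP ->; apply: g2D => -[_] /=; rewrite ltxx.
Qed.

End Action.

(** * Orbit maps and minimal fixing sets for a continuous [psi] *)

Section ContinuousAction.
Context {R : realType} (psi : {multiplicative homeo_c R -> homeo R}).
Hypothesis psi_continuous : continuous psi.
Implicit Types (f g k : homeo_c R) (D : set R) (P : seq R) (z : R).

Lemma act_close z (e : R) : 0 < e -> exists M d : R, 0 < d /\
  forall f, (forall x, `|x| <= M -> `|val f x - x| < d) -> `|psi f z - z| < e.
Proof.
move=> e0; apply: homeo_c_nbhs1.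
have psi1 : psi 1%g = 1%g by apply: homeo_ext => x; exact: act1.
have : nbhs (psi 1%g) [set g : homeo R | `|g z - z| < e].
  by rewrite psi1; exact: homeo_nbhs1.
exact: psi_continuous.
Qed.

Lemma stabilizer_has_fixed_point : exists P z, fixed_by psi (stabilizer P) z.
Proof.
have [|M [d [d0 close0]]] := @act_close 0 (1 / 2); first lra.
have [|N [e [e0 close1]]] := @act_close 1 (1 / 2); first lra.
have de0 : 0 < Num.min d e by rewrite lt_min d0.
have [P closeP] := grid_stabilizer_close (Num.max M N) de0.
have near0 f : stabilizer P f -> `|psi f 0| < 1 / 2.
  move=> fP; rewrite -[psi f 0]subr0; apply: close0 => x xM.
  by have := closeP f fP x; rewrite le_max xM lt_min => /(_ isT) /andP[].
have near1 f : stabilizer P f -> `|psi f 1 - 1| < 1 / 2.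
  move=> fP; apply: close1 => x xN.
  by have := closeP f fP x; rewrite le_max xN orbT lt_min => /(_ isT) /andP[].
exists P, (sup [set psi f 0 | f in stabilizer P]); apply: sup_fixed.
- exact: stabilizerV.
(* The bounds give [psi f 0 < 1 / 2 < psi f 1], so [psi f] is not decreasing. *)
- move=> f fP; have [//|fd] := act_monotone psi f.
  have := fd 1 0 ltr01; have := near0 f fP; have := near1 f fP.
  by rewrite !ltr_norml; lra.
- split; first by exists (psi 1%g 0), 1%g.
  exists 1 => _ [f fP <-]; have := near0 f fP; rewrite ltr_norml; lra.
- move=> f _ fP [g gP <-]; exists (f * g)%g; first exact: stabilizerM.
  by rewrite actM.
Qed.

(** [Phi] sends [f p] to [psi f z], which is well defined because the stabilizer of [p] fixes [z].
    If [Phi a = Phi b] with [a != b], this value is fixed by both stabilizers, hence by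
    [supported_in D], and then so is [z]. Continuity holds since nearby points are joined by bumps
    close to the identity. *)
Lemma orbit_map D p z : open D -> is_interval D -> D p ->
  fixed_by psi (supported_in D `&` stabilizer [:: p]) z ->
  ~ fixed_by psi (supported_in D) z ->
  exists Phi : R -> R, [/\ Phi p = z,
    forall f x, supported_in D f -> D x -> Phi (val f x) = psi f (Phi x),
    {in D &, injective Phi} & {in D, continuous Phi}].
Proof.
move=> oD iD Dp zp zD.
pose S x := [set f | supported_in D f /\ val f p = x].
(* The fallback value [1] can only occur off [D], since bumps carry [p] to every point of [D]. *)
pose Phi x := psi (xget 1%g (S x)) z.
have PhiE f : supported_in D f -> Phi (val f p) = psi f z.
  move=> fD; have [gD gp] : S (val f p) (xget 1%g (S (val f p))).
    by apply: xgetPex; exists f.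
  rewrite /Phi; set g := xget _ _ in gD gp *.
  have kD : (supported_in D `&` stabilizer [:: p]) (g^-1 * f)%g.
    split; first by apply: supported_inM => //; exact: supported_inV.
    by move=> x; rewrite inE => /eqP ->; rewrite homeo_cM -gp homeo_cVK.
  by rewrite -[f](mulVKg g) actM (zp _ kD).
have PhiP x : D x ->
    exists2 f, supported_in D f /\ val f p = x & Phi x = psi f z.
  move=> Dx; have [f [fD fp _]] := bump_supported_in oD iD Dp Dx.
  by exists f => //; rewrite -fp PhiE.
have PhiM f x : supported_in D f -> D x -> Phi (val f x) = psi f (Phi x).
  move=> fD /PhiP[g [gD <-] ->]; rewrite -homeo_cM PhiE ?actM //.
  exact: supported_inM.
exists Phi; split => //.
- have := PhiE 1%g; rewrite act1; apply=> //.
- move=> a b; rewrite !inE => Da Db Phiab; apply/eqP/negPn/negP => ab.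
  apply: zD; have [k [kD kp] Phik] := PhiP a Da.
  have Pa : fixed_by psi (supported_in D) (Phi a).
    apply: (fixed_by_supported_in oD iD Da Db ab).
      move=> f [fD fa]; rewrite -PhiM // fa //; exact: mem_head.
    move=> f [fD fb]; rewrite Phiab -PhiM // fb //; exact: mem_head.
  have -> // : z = Phi a.
  by rewrite -[z](actVK psi k) -Phik Pa //; exact: supported_inV.
- move=> x; rewrite inE => Dx; apply/cvgrPdist_lt => e e0.
  have [M [d [d0 dP]]] := act_close (Phi x) e0.
  have Dn : nbhs x D by exact: open_nbhs_nbhs.
  near=> y; have Dy : D y by near: y.
  have [f [fD fx fclose]] := bump_supported_in oD iD Dx Dy.
  rewrite -fx PhiM // distrC; apply: dP => t _.
  apply: le_lt_trans (fclose t) _; rewrite distrC; near: y.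
  by have := nbhsx_ballx x d d0; rewrite -ball_normE.
Unshelve. all: by end_near. Qed.

(* Two orbit maps through [z] would both be continuous and injective, so they
   would meet again at some [w != z]; this [w] is then fixed by the stabilizers
   in [supported_in D] of two distinct points, hence by all of it. *)
Lemma fixed_by_disjoint D D' p q z : open D -> is_interval D -> D p ->
  open D' -> is_interval D' -> D' q -> D `&` D' = set0 ->
  fixed_by psi (supported_in D `&` stabilizer [:: p]) z ->
  fixed_by psi (supported_in D' `&` stabilizer [:: q]) z ->
  fixed_by psi (supported_in D) z \/ fixed_by psi (supported_in D') z.
Proof.
move=> oD iD Dp oD' iD' Dq DD' zp zq.
have [//|nzD] := pselect (fixed_by psi (supported_in D) z); first by left.
have [//|nzD'] := pselect (fixed_by psi (supported_in D') z); first by right.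
exfalso.
have [Phi [Phip PhiM PhiI Phic]] := orbit_map oD iD Dp zp nzD.
have [Psi [Psiq PsiM PsiI Psic]] := orbit_map oD' iD' Dq zq nzD'.
have [r r0 rD] : exists2 r : R, 0 < r & `[p - r, p + r]%classic `<=` D.
  have : nbhs p D by exact: open_nbhs_nbhs.
  move=> /nbhs_ballP[r /= r0 rD]; exists (r / 2); first by lra.
  move=> t /=; rewrite in_itv /= => tr.
  by apply: rD; rewrite -ball_normE /= ltr_norml; lra.
have inD t : t \in `[p - r, p + r] -> t \in D.
  by move=> tr; rewrite inE; exact: rD.
have cPhi : {within `[p - r, p + r], continuous Phi}.
  by apply: continuous_in_subspaceT => t; rewrite inE => /inD /Phic.
have IPhi : {in `[p - r, p + r] &, injective Phi}.
  by move=> s t /inD Ds /inD Dt; exact: PhiI.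
have [pl pm pr] : [/\ p - r \in `[p - r, p + r], p \in `[p - r, p + r] &
    p + r \in `[p - r, p + r]].
  by split; rewrite in_itv /=; lra.
(* [Phi] may increase or decrease; either way [z = Phi p] is strictly between its end values. *)
set m := Num.min (Phi (p - r)) (Phi (p + r)).
set n := Num.max (Phi (p - r)) (Phi (p + r)).
have zmn : z \in `]m, n[.
  rewrite -Phip in_itv /= /m /n gt_min lt_max.
  have [fm|fm] := itv_continuous_inj_mono cPhi IPhi.
    by rewrite (fm (p - r) p) ?(fm p (p + r)) ?orbT //; lra.
  by rewrite (fm (p + r) p) ?(fm p (p - r)) ?orbT //; lra.
have [b [Db bq bmn]] : exists b, [/\ D' b, b != q & Psi b \in `]m, n[].
  have qD' : q \in D' by rewrite inE.
  have : nbhs q (D' `&` (Psi @^-1` `]m, n[)).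
    apply: filterI; first exact: open_nbhs_nbhs.
    by apply: (Psic q qD'); rewrite Psiq; exact: near_in_itvoo.
  move=> /nbhs_ballP[s /= s0 sD].
  have /sD[Db bmn] : ball q s (q + s / 2).
    by rewrite -ball_normE /= ltr_norml; lra.
  by exists (q + s / 2); split => //; rewrite gt_eqF //; lra.
have [||a ar ab] := @IVT R Phi (p - r) (p + r) (Psi b) _ cPhi; first lra.
  by move: bmn; rewrite in_itv /= => /andP[? ?]; rewrite !ltW.
have nbz : Psi b != z.
  by apply: contra_neq bq; rewrite -Psiq; apply: PsiI; rewrite inE.
have Da : D a by apply: rD.
have pa : p != a by apply: contra_neq nbz => pa; rewrite -ab -pa Phip.
have [k [kD kp _]] := bump_supported_in oD iD Dp Da.
have kz : psi k z = Psi b by rewrite -Phip -PhiM // kp.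
have [g [gD gq _]] := bump_supported_in oD' iD' Dq Db.
have gz : psi g z = Psi b by rewrite -Psiq -PsiM // gq.
have fixb : fixed_by psi (supported_in D) (Psi b).
  apply: (fixed_by_supported_in oD iD Dp Da pa).
    (* [g] is supported in [D'], so it commutes with [f] and carries the fixed point [z] of [f] to
       another one, [Psi b]. *)
    move=> f [fD fp]; rewrite -gz -actM (supported_in_commute DD' fD gD) actM.
    by rewrite zp.
  by move=> f [fD fa]; rewrite -ab -PhiM // fa // mem_head.
case/eqP: nbz; rewrite -[RHS](actVK psi k z) kz fixb //.
exact: supported_inV.
Qed.

Lemma itvoo_open_interval (a b : R) :
  open `]a, b[%classic /\ is_interval `]a, b[%classic.
Proof. by split; [exact: itv_open|exact: interval_is_interval]. Qed.

Lemma seq_nil_or_singleton_or_other P : P = [::] \/ exists p, p \in P /\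
  ({subset P <= [:: p]} \/ exists2 q, q \in P & q != p).
Proof.
case: P => [|p P]; [by left|right; exists p; split; first exact: mem_head].
have [/hasP[q qP qp]|/hasPn nP] := boolP (has (predC1 p) (p :: P)).
  by right; exists q.
by left => q /nP /=; rewrite negbK inE.
Qed.

Lemma point_stabilizer_has_fixed_point :
  ~ (exists z, fixed_by psi setT z) ->
  exists p z, fixed_by psi (stabilizer [:: p]) z.
Proof.
move=> nofix.
pose fixing n := `[< exists P z, size P = n /\ fixed_by psi (stabilizer P) z >].
have [P0 [z0 zP0]] := stabilizer_has_fixed_point.
have exn : exists n, fixing n.
  by exists (size P0); apply/asboolP; exists P0, z0.
case: (ex_minnP exn) => n /asboolP[P [z [sizeP zP]]] minn.
(* Otherwise [p] could be removed from [P], against minimality. *)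
have local p (r : R) : p \in P -> 0 < r ->
    ~ fixed_by psi (supported_in `]p - r, p + r[%classic) z.
  move=> pP r0 zr; have := fixed_by_stabilizer_remove r0 zP zr => zP'.
  have /minn : fixing (size [seq q <- P | q != p]).
    by apply/asboolP; exists [seq q <- P | q != p], z.
  rewrite -sizeP leqNgt size_filter -(count_predC (predC1 p)).
  rewrite -[X in (X < _)%N]addn0.
  by rewrite ltn_add2l -has_count => /hasPn/(_ p pP); rewrite /= negbK eqxx.
have [Pnil|[p [pP [Pp|[q qP qp]]]]] := seq_nil_or_singleton_or_other P.
- by case: nofix; exists z => f _; apply: zP; rewrite Pnil.
- by exists p, z => f fp; apply: zP => x /Pp; exact: fp.
exfalso.
have [r r0 rp] := seq_gap P p; have [s s0 sq] := seq_gap P q.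
(* Half the smaller gap: the intervals of radius [t] about [p] and [q] are disjoint and meet [P]
   only at their centres, so an element supported in one and fixing its centre stabilizes [P]. *)
pose t := Num.min r s / 2.
have [t0 tr ts] : [/\ 0 < t, t * 2 <= r & t * 2 <= s].
  rewrite /t divfK ?pnatr_eq0 // !ge_min !lexx orbT divr_gt0 ?lt_min ?r0 //.
have [op ip] := itvoo_open_interval (p - t) (p + t).
have [oq iq] := itvoo_open_interval (q - t) (q + t).
have sub x u : {in P, forall y, y != x -> u <= `|y - x|} ->
    t * 2 <= u -> x \in P ->
    fixed_by psi (supported_in `]x - t, x + t[%classic `&` stabilizer [:: x]) z.
  move=> gap tu xP f [fx fxx]; apply: zP => y yP.
  have [->|yx] := eqVneq y x; first by apply: fxx; rewrite mem_head.
  apply: fx => /=; rewrite in_itv /= => yt; have := gap y yP yx.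
  by rewrite leNgt ltr_norml => /negP; apply; lra.
have inI x : `]x - t, x + t[%classic x by rewrite /= in_itv /=; lra.
have disj : `]p - t, p + t[%classic `&` `]q - t, q + t[%classic = set0.
  apply/seteqP; split => // y [] /=; rewrite !in_itv /= => yp yq.
  by have := rp q qP qp; rewrite leNgt ltr_norml => /negP; apply; lra.
case: (fixed_by_disjoint op ip (inI p) oq iq (inI q) disj (sub p r rp tr pP)
  (sub q s sq ts qP)); exact: local.
Qed.

End ContinuousAction.

(** * The conjugacy as a surjective orbit map of the whole line *)

Theorem theorem3p1 (R : realType)
    (psi : {multiplicative homeo_c R -> homeo R})
    (psi_continuous : continuous psi)
    (psi_nofix : ~ exists x : R, forall f : homeo_c R, psi f x = x) :
  exists h : homeo R, forall f : homeo_c R,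
    psi f = h \o val f \o (h^-1)%g :> (R -> R).
Proof.
have nofix : ~ exists z, fixed_by psi setT z.
  by move=> [z zT]; apply: psi_nofix; exists z => f; exact: zT.
have [p [z zp]] := point_stabilizer_has_fixed_point psi_continuous nofix.
have supT (f : homeo_c R) : supported_in setT f by move=> x /(_ I).
have [||||Phi [_ PhiM PhiI Phic]] :=
  @orbit_map R psi psi_continuous setT p z openT.
- by [].
- by [].
- by move=> f [_]; exact: zp.
- by move=> zT; apply: nofix; exists z => f _; exact/zT/supT.
have {}PhiM (f : homeo_c R) x : Phi (val f x) = psi f (Phi x).
  exact: PhiM (supT f) I.
have {}PhiI : injective Phi by move=> x y; apply: PhiI; rewrite inE.
have {}Phic : continuous Phi by move=> x; apply: Phic; rewrite inE.
(* [Phi] is monotone and [f] increasing, so [Phi (f 0)] and [Phi (f 1)] are ordered like [Phi 0] and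
   [Phi 1]; a decreasing [psi f] would reverse them. *)
have psi_incr f : {homo psi f : x y / x < y}.
  have [//|fd] := act_monotone psi f.
  have f01 : val f 0 < val f 1 by rewrite ltr_homeo_c.
  by have [fm|fm] := continuous_injective_monotone Phic PhiI;
    have := fd _ _ (fm _ _ ltr01); rewrite -!PhiM => /lt_trans/(_ (fm _ _ f01));
    rewrite ltxx.
have rangeM f y : range Phi y -> range Phi (psi f y).
  by move=> [x _ <-]; exists (val f x).
have sup_absurd (S : set R) :
    has_sup S -> (forall f y, S y -> S (psi f y)) -> False.
  move=> supS SM; apply: nofix; exists (sup S).
  by apply: sup_fixed => // f y _; exact: SM.
have above y : exists a, y < Phi a.
  apply: contrapT => ny; apply: (sup_absurd (range Phi)) rangeM.
  split; first by exists (Phi 0), 0.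
  exists y => _ [x _ <-]; rewrite leNgt; apply/negP => yx.
  by apply: ny; exists x.
have below y : exists b, Phi b < y.
  (* The infimum of the range is treated as the supremum of its lower bounds, an invariant set
     because every [psi f] is increasing. *)
  apply: contrapT => ny; apply: (sup_absurd (lbound (range Phi))).
    split.
      exists y => _ [x _ <-]; rewrite leNgt; apply/negP => yx.
      by apply: ny; exists x.
    by exists (Phi 0) => w; apply; exists 0.
  move=> f w lbw s rs; rewrite -(actKV psi f s) (le_mono (psi_incr f)).
  by apply: lbw; exact: rangeM.
have surj y : exists x, Phi x = y.
  have [[a ya] [b by_]] := (above y, below y).
  have [||c _ cy] := @IVT R Phi (Num.min a b) (Num.max a b) y _
    (continuous_subspaceT Phic).
  - by rewrite ge_min !le_max lexx.
  - case: (leP a b) => _; rewrite ge_min le_max !(ltW ya) !(ltW by_) ?orbT //.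
  by exists c.
have [Psi PsiK] := choice surj.
have PhiK : cancel Phi Psi by move=> x; apply: PhiI; rewrite PsiK.
have Psic : continuous Psi.
  move=> y; rewrite -(PsiK y).
  have PhiK' : {near Psi y, cancel Phi Psi} by near=> x; exact: PhiK.
  have Phic' : {near Psi y, continuous Phi} by near=> x; exact: Phic.
  exact: (nbhs_singleton (near_can_continuous PhiK' Phic')).
exists (Homeo PhiK PsiK Phic Psic) => f.
by apply/funext => y /=; rewrite PhiM PsiK.
Unshelve. all: by end_near. Qed.
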